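(* Let $N=(N_t)_{t\ge 0}$ be a non-homogeneous Poisson process, defined on a probability space with probability $\mathbb{P}$, with continuous intensity function $\lambda:[0,\infty)\to[0,\infty)$. Let $\tau^*>0$ and $m>0$ be such that $\lambda(t)=m$ for every $t\ge\tau^*$. For $\tau>\tau^*$ and $h\ge 0$ define $$\widehat m_\tau=\frac{N_\tau-N_{\tau^*}}{\tau-\tau^*},\qquad \widehat G_\tau(h)=1-\exp(-\widehat m_\tau h),\qquad G(h)=1-\exp(-mh).$$ Then $$\lim_{\tau\to\infty}\ \sup_{h\ge 0}\bigl|\widehat G_\tau(h)-G(h)\bigr|=0\qquad \mathbb{P}\text{-almost surely}.$$
   Context: A non-homogeneous Poisson process $N$ with intensity function $\lambda$ is a counting process with $N_0=0$, independent increments, right-continuous paths with left limits, and $N_t-N_s$ Poisson distributed with mean $\Lambda(t)-\Lambda(s)$ for $0\le s\le t$, where $\Lambda(t)=\int_0^t\lambda(u)\,du$ is the cumulative intensity function. *)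

(* Defs.v *)
From HB Require Import structures.
From mathcomp Require Import all_boot all_order all_algebra.
From mathcomp Require Import all_classical all_reals all_analysis.
Import Order.TTheory GRing.Theory Num.Theory.
Import numFieldNormedType.Exports.

Set Implicit Arguments.
Unset Strict Implicit.
Unset Printing Implicit Defensive.

Local Open Scope classical_set_scope.
Local Open Scope ring_scope.

Definition mutually_independent (R : realType) (d d' : measure_display)
    (T : measurableType d) (T' : measurableType d') (P : probability T R)
    (I : finType) (X : I -> T -> T') : Prop :=
  forall (J : {set I}) (A : I -> set T'), (forall i, measurable (A i)) ->
    P (\big[setI/setT]_(i in J) (X i @^-1` A i)) =
    (\prod_(i in J) P (X i @^-1` A i))%E.

(* Processes indexed by [0, +oo[ are represented by functions on all of R,
   whose values at negative times are never constrained. *)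

(* The subtraction is truncated; it is only used for processes with
   nondecreasing paths and for s <= t. *)
Definition increment (R : realType) (T : Type) (N : R -> T -> nat) (s t : R)
    (w : T) : nat := (N t w - N s w)%N.

Definition cumulative_intensity (R : realType) (lambda : R -> R) (t : R) : R :=
  \int[lebesgue_measure]_(u in `[0, t]) lambda u.

Record counting_process (R : realType) (d : measure_display)
    (T : measurableType d) (N : R -> T -> nat) : Prop := {
  counting_measurable : forall t, 0 <= t -> measurable_fun [set: T] (N t) ;
  counting_nondecreasing :
    forall w s t, 0 <= s -> s <= t -> (N s w <= N t w)%N }.

Definition independent_increments (R : realType) (d : measure_display)
    (T : measurableType d) (P : probability T R) (N : R -> T -> nat) : Prop :=
  forall (n : nat) (t : nat -> R), 0 <= t 0%N ->
    {homo t : i j / (i <= j)%N >-> i <= j} ->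
    mutually_independent P (fun i : 'I_n => increment N (t i) (t i.+1)).

(* The topology of nat is the discrete one, i.e., the one induced by R.
   poisson_prob r is the Dirac measure at 0 when r = 0, and its second
   argument (here 0) is a dummy. *)
Record nonhomogeneous_poisson_process (R : realType) (d : measure_display)
    (T : measurableType d) (P : probability T R) (lambda : R -> R)
    (N : R -> T -> nat) : Prop := {
  nhpp_counting : counting_process N ;
  nhpp_start : forall w, N 0 w = 0%N ;
  nhpp_indep : independent_increments P N ;
  nhpp_right_continuous :
    forall w t, 0 <= t -> N s w @[s --> t^'+] --> N t w ;
  nhpp_left_limits :
    forall w t, 0 < t -> cvg (N s w @[s --> t^'-]) ;
  nhpp_poisson : forall s t, 0 <= s -> s <= t -> forall A : set nat,
    pushforward P (increment N s t) A =
    poisson_prob (cumulative_intensity lambda t - cumulative_intensity lambda s)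
      0%N A }.

Definition m_hat (R : realType) (T : Type) (N : R -> T -> nat)
    (taustar tau : R) (w : T) : R :=
  ((N tau w)%:R - (N taustar w)%:R) / (tau - taustar).

Definition G_hat (R : realType) (T : Type) (N : R -> T -> nat)
    (taustar tau : R) (w : T) (h : R) : R :=
  1 - expR (- m_hat N taustar tau w * h).

Definition G (R : realType) (m h : R) : R := 1 - expR (- m * h).

(* Main.v *)
Require Import Defs.
From HB Require Import structures.
From mathcomp Require Import all_boot all_order all_algebra.
From mathcomp Require Import all_classical all_reals all_analysis.
From mathcomp Require Import measurable_realfun ring lra.
Import Order.TTheory GRing.Theory Num.Theory.
Import numFieldNormedType.Exports.

Local Open Scope classical_set_scope.
Local Open Scope ring_scope.

(** After [taustar] the intensity is the constant [m], so the increment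
    [X s = N (taustar + s) - N taustar] has the Poisson law of parameter
    [m * s] ([cumulative_intensity_sub]). The estimator is [X s / s] with
    [s = tau - taustar], and the proof has two halves.

    Consistency of the rate: [X s / s] tends to [m] almost surely
    ([ae_cvg_poisson_rate]). A Poisson variable has variance equal to its
    parameter ([poisson_variance]), so the mean square error of [X s / s] is
    [m / s]. Along the grid [s = (n + 1) * (n + 2)] these errors have a finite
    sum, hence the squared errors are almost surely summable and tend to zero
    ([ae_cvg0_summable_integral]). The paths of [N] are nondecreasing and
    consecutive grid points have ratio tending to one, which extends the
    convergence from the grid to all real [s] ([cvg_ratio_nondecreasing]).

    Continuity of the distribution function in its rate, uniformly in [h]: the
    exponential distribution functions of rates [a] and [b] differ by at most
    [`|a - b| / min a b] ([expR_abs_sub_le]), so the supremum in the theorem is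
    eventually at most [`|a - m| / (m / 2)], where [a] is the estimated rate
    ([ereal_sup_G_cvg0]). *)

(** * The variance of the Poisson law *)

Lemma ge0_integral_nat_comp (R : realType) (d : measure_display)
    (T : measurableType d) (mu : {measure set T -> \bar R}) (X : T -> nat)
    (g : nat -> \bar R) :
  measurable_fun setT X -> (forall k, 0 <= g k)%E ->
  (\int[mu]_w g (X w) = \sum_(k <oo) g k * mu (X @^-1` [set k]))%E.
Proof.
move=> mX g0.
have mXk k : measurable (X @^-1` [set k]).
  by rewrite -[_ @^-1` _]setTI; exact: mX.
have mg : measurable_fun setT (g \o X).
  by apply: (@measurableT_comp _ _ _ _ _ _ g).
have -> : [set: T] = \bigcup_k X @^-1` [set k].
  by apply/seteqP; split => // w _; exists (X w).
rewrite ge0_integral_bigcup//.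
- apply: eq_eseriesr => k _.
  rewrite (eq_integral (cst (g k))); last by move=> w; rewrite inE => /= <-.
  by rewrite integral_cst.
- by apply: measurable_funS mg.
- by apply/trivIsetP => i j _ _ /eqP ij; apply/seteqP; split => // w [/= ->].
Qed.

(** The series of the second central moment of the Poisson law with parameter
    [r], without its factor [expR (- r)]. With [a k = r ^+ k / k`!] and
    [b k = k * (k - r) * a k], the recurrence [(k + 1) * a (k + 1) = r * a k]
    gives [(k - r) ^+ 2 * a k - r * a k = b k - b (k + 1)]: up to the vanishing
    term [b n], the partial sums are [r] times those of the exponential
    series. *)
Lemma cvg_sum_poisson_sq_dev (R : realType) (r : R) :
  series (fun k => (k%:R - r) ^+ 2 * exp_coeff r k) @ \oo --> r * expR r.
Proof.
pose b (n : nat) : R := n%:R * (n%:R - r) * exp_coeff r n.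
have expS n : n.+1%:R * exp_coeff r n.+1 = r * exp_coeff r n.
  rewrite /exp_coeff/= factS natrM exprS.
  have := fact_gt0 n; rewrite -(ltr0n R) => f0; field.
  by rewrite (gt_eqF f0) addrC natr1 pnatr_eq0.
have sumE n : series (fun k => (k%:R - r) ^+ 2 * exp_coeff r k) n =
    r * series (exp_coeff r) n - b n.
  rewrite !seriesEnat/=; elim: n => [|n IH].
    by rewrite !big_geq// /b mul0r mul0r mulr0 subr0.
  rewrite !big_nat_recr//= IH /b.
  have -> : n.+1%:R * (n.+1%:R - r) * exp_coeff r n.+1 =
     (n.+1%:R - r) * (r * exp_coeff r n) by rewrite -expS; ring.
  by rewrite -natr1; ring.
have b_shift : (fun n => b (n + 2)%N) =
    (fun n => r ^+ 2 * exp_coeff r n + r * (1 - r) * exp_coeff r n.+1).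
  apply/funext => n; rewrite addn2 /b.
  transitivity ((n.+2%:R - r) * (n.+2%:R * exp_coeff r n.+2)); first by ring.
  rewrite expS.
  transitivity (r * (n.+1%:R * exp_coeff r n.+1) +
                r * (1 - r) * exp_coeff r n.+1).
    by rewrite -[n.+2%:R]natr1; ring.
  by rewrite expS; ring.
have b0 : b @ \oo --> (0 : R).
  have : (fun n => b (n + 2)%N) @ \oo --> r ^+ 2 * 0 + r * (1 - r) * 0.
    rewrite b_shift; apply: cvgD; (apply: cvgM; first exact: cvg_cst).
      exact: cvg_exp_coeff.
    by rewrite (cvg_shiftS (exp_coeff r)); exact: cvg_exp_coeff.
  by rewrite !mulr0 addr0 cvg_shiftn.
rewrite (funext sumE) -[r * expR r]subr0.
apply: cvgB b0; apply: cvgM; first exact: cvg_cst.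
exact: is_cvg_series_exp_coeff.
Qed.

Lemma poisson_prob_set1 (R : realType) (r : R) (i k : nat) : 0 < r ->
  poisson_prob r i [set k] = (exp_coeff r k * expR (- r))%:E.
Proof.
move=> r0; rewrite /poisson_prob r0 esum_set1 ?lee_fin ?poisson_pmf_ge0//.
by rewrite /poisson_pmf r0.
Qed.

Lemma poisson_variance (R : realType) (d : measure_display)
    (T : measurableType d) (P : probability T R) (X : T -> nat) (r : R) :
  0 < r -> measurable_fun setT X ->
  (forall A, pushforward P X A = poisson_prob r 0%N A) ->
  (\int[P]_w (((X w)%:R - r) ^+ 2)%:E = r%:E)%E.
Proof.
move=> r0 mX PX.
rewrite (@ge0_integral_nat_comp _ _ _ P X
    (fun k => ((k%:R - r) ^+ 2)%:E))//; last by move=> k; rewrite lee_fin sqr_ge0.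
apply/cvg_lim => //.
have cvg_dev : (fun n => expR (- r) *
      series (fun k => (k%:R - r) ^+ 2 * exp_coeff r k) n) @ \oo --> r.
  rewrite [X in _ --> X](_ : r = expR (- r) * (r * expR r)); last first.
    by rewrite mulrCA -expRD addNr expR0 mulr1.
  by apply: cvgM; [exact: cvg_cst|exact: cvg_sum_poisson_sq_dev].
rewrite (_ : (fun n => _) = EFin \o (fun n =>
    expR (- r) * series (fun k => (k%:R - r) ^+ 2 * exp_coeff r k) n)).
  by apply: cvg_EFin; [exact: nearW|exact: cvg_dev].
apply/funext => n /=; rewrite mulr_sumr -sumEFin; apply: eq_bigr => k _.
have := PX [set k]; rewrite /pushforward => ->.
by rewrite poisson_prob_set1// -EFinM; congr EFin; ring.
Qed.

(** * A strong law of large numbers under monotonicity *)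

(** A substitute for the Chebyshev and Borel-Cantelli argument: by monotone
    convergence the sum of the [f n] has a finite integral, so it is finite
    almost everywhere, and the terms of a convergent series tend to zero. *)
Lemma ae_cvg0_summable_integral (R : realType) (d : measure_display)
    (T : measurableType d) (mu : {measure set T -> \bar R})
    (f : nat -> T -> R) :
  (forall n, measurable_fun setT (f n)) -> (forall n w, 0 <= f n w) ->
  (\sum_(n <oo) \int[mu]_w (f n w)%:E < +oo)%E ->
  {ae mu, forall w, f n w @[n --> \oo] --> (0 : R)}.
Proof.
move=> mf f0 foo.
have mEf n : measurable_fun setT (EFin \o f n) by exact/measurable_EFinP.
pose g w := (\sum_(n <oo) (f n w)%:E)%E.
have g0 w : (0 <= g w)%E by apply: nneseries_ge0 => n _ _; rewrite lee_fin.
have ig : mu.-integrable setT g.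
  apply/integrableP; split.
    apply: ge0_emeasurable_sum => [n w _ _|n _]; last exact: mEf.
    by rewrite /= lee_fin.
  rewrite (eq_integral g); last by move=> w _; rewrite gee0_abs.
  by rewrite integral_nneseries// => n w _; rewrite lee_fin.
apply: filterS (integrable_ae measurableT ig) => w /(_ I) gw.
apply/cvg_series_cvg_0/nnseries_is_cvg => //.
by rewrite -ge0_fin_numE ?g0.
Qed.

(** For [t n <= x <= t n.+1] monotonicity gives
    [F (t n) / t n.+1 <= F x / x <= F (t n.+1) / t n], and both bounds tend to
    [m] since consecutive points of the grid are asymptotically equivalent. *)
Lemma cvg_ratio_nondecreasing (R : realType) (F : R -> R) (t : nat -> R)
    (m : R) :
  (forall n, 0 < t n) -> nondecreasing_seq t -> t @ \oo --> +oo ->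
  t n / t n.+1 @[n --> \oo] --> (1 : R) ->
  (forall x y, 0 <= x -> x <= y -> F x <= F y) -> 0 <= F 0 ->
  F (t n) / t n @[n --> \oo] --> m ->
  F x / x @[x --> +oo] --> m.
Proof.
move=> t0 tnd too trat Fnd F0 Ftm.
have Fge0 x : 0 <= x -> 0 <= F x by move=> x0; apply: le_trans F0 (Fnd _ _ _ _).
have lo : F (t n) / t n.+1 @[n --> \oo] --> m.
  rewrite (_ : (fun n => _) = (fun n => F (t n) / t n * (t n / t n.+1))).
    by rewrite -[m]mulr1; exact: cvgM Ftm trat.
  by apply/funext => n; rewrite mulrA divfK// gt_eqF.
have hi : F (t n.+1) / t n @[n --> \oo] --> m.
  rewrite (_ : (fun n => _) =
      (fun n => F (t n.+1) / t n.+1 / (t n / t n.+1))).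
    have Ftm' : F (t n.+1) / t n.+1 @[n --> \oo] --> m.
      by rewrite (cvg_shiftS (fun n => F (t n) / t n)).
    have trat' : (t n / t n.+1)^-1 @[n --> \oo] --> (1^-1 : R).
      exact: cvgV (oner_neq0 R) trat.
    by rewrite -[m]mulr1 -[1]invr1; exact: cvgM Ftm' trat'.
  by apply/funext => n; rewrite invf_div mulrA divfK// gt_eqF.
apply/cvgrPdist_lt => e e0.
move/cvgrPdist_lt : lo => /(_ e e0) [K1 _ lo].
move/cvgrPdist_lt : hi => /(_ e e0) [K2 _ hi].
pose K := maxn K1 K2.
near=> x.
have x_ge : t K <= x by near: x; apply: nbhs_pinfty_ge; exact: num_real.
have x0 : 0 < x by exact: lt_le_trans (t0 K) x_ge.
(* The least M with x < t M is some n.+1 with K <= n and t n <= x < t n.+1. *)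
have exM : exists M, x < t M.
  by move/cvgryPgt : too => /(_ x) [M _ /(_ M (leqnn M))]; exists M.
case: (ex_minnP exM) => -[|n] xn nmin.
  by move: xn; rewrite ltNge (le_trans _ x_ge)// tnd.
have tnx : t n <= x by rewrite leNgt; apply/negP => /nmin; rewrite ltnn.
have Kn : (K <= n)%N.
  rewrite -ltnS ltnNge; apply/negP => nK.
  by move: xn; rewrite ltNge (le_trans _ x_ge)// tnd.
have K1n : (K1 <= n)%N by rewrite (leq_trans _ Kn)// leq_maxl.
have K2n : (K2 <= n)%N by rewrite (leq_trans _ Kn)// leq_maxr.
move: (lo n K1n) (hi n K2n) => /=; rewrite !ltr_distlC.
move=> /andP[lo1 _] /andP[_ hi1]; apply/andP; split.
- apply: lt_le_trans lo1 _.
  apply: ler_pM; rewrite ?invr_ge0 ?Fge0 ?(ltW x0) ?(ltW (t0 _))//.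
    by rewrite Fnd// ltW.
  by rewrite lef_pV2 ?posrE// ltW.
- apply: le_lt_trans hi1.
  apply: ler_pM; rewrite ?invr_ge0 ?Fge0 ?(ltW x0)//.
    by rewrite Fnd// ltW.
  by rewrite lef_pV2 ?posrE.
Unshelve. all: by end_near. Qed.

(** A strong law of large numbers for monotone families with Poisson
    marginals: the variance of [X s / s] is [m / s], which is summable along
    [s = (n + 1) * (n + 2)]; this gives almost sure convergence along that grid,
    and monotonicity fills the gaps. *)
Lemma ae_cvg_poisson_rate (R : realType) (d : measure_display)
    (T : measurableType d) (P : probability T R) (X : R -> T -> nat) (m : R) :
  0 < m ->
  (forall s, 0 <= s -> measurable_fun setT (X s)) ->
  (forall w s t, 0 <= s -> s <= t -> (X s w <= X t w)%N) ->
  (forall s, 0 <= s -> forall A,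
    pushforward P (X s) A = poisson_prob (m * s) 0%N A) ->
  {ae P, forall w, (X s w)%:R / s @[s --> +oo] --> m}.
Proof.
move=> m0 mX Xnd PX.
(* Consecutive integers rather than a square, so that the sum of 1 / t n
   telescopes. *)
pose t (n : nat) : R := n.+1%:R * n.+2%:R.
have t0 n : 0 < t n by rewrite mulr_gt0.
have tV n : (t n)^-1 = harmonic n - harmonic n.+1.
  rewrite /t /=; have := ltr0Sn R n; have := ltr0Sn R n.+1.
  by rewrite -[n.+2%:R]natr1 => h1 h2; field; rewrite !gt_eqF.
have mXR n : measurable_fun setT (fun w => (X (t n) w)%:R : R).
  have mnat : measurable_fun setT (fun k : nat => k%:R : R) by [].
  exact: measurableT_comp mnat (mX _ (ltW (t0 n))).
pose f n w : R := ((X (t n) w)%:R / t n - m) ^+ 2.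
have mf n : measurable_fun setT (f n).
  apply: measurable_funX; apply: measurable_funB => //.
  exact: measurable_funM.
have intf n : (\int[P]_w (f n w)%:E = (m * (t n)^-1)%:E)%E.
  have -> : (fun w => (f n w)%:E) =
      (fun w => ((t n)^-1 ^+ 2)%:E * (((X (t n) w)%:R - m * t n) ^+ 2)%:E)%E.
    apply/funext => w; rewrite -EFinM /f; congr EFin.
    by field; rewrite gt_eqF.
  rewrite ge0_integralZl//; last 3 first.
  - apply/measurable_EFinP; apply: measurable_funX; exact: measurable_funB.
  - by move=> w _; rewrite lee_fin sqr_ge0.
  - by rewrite lee_fin sqr_ge0.
  rewrite (@poisson_variance _ _ _ _ (X (t n)) (m * t n)) ?mulr_gt0//;
    last 2 first.
  - by apply: mX; exact: ltW.
  - by apply: PX; exact: ltW.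
  rewrite -EFinM; congr EFin.
  by field; rewrite gt_eqF.
have sumf : (\sum_(n <oo) \int[P]_w (f n w)%:E < +oo)%E.
  apply: (@le_lt_trans _ _ m%:E); last exact: ltry.
  apply: lime_le.
    apply: is_cvg_nneseries => n _ _.
    by rewrite integral_ge0// => w _; rewrite lee_fin sqr_ge0.
  apply: nearW => n; under eq_bigr do rewrite intf tV.
  rewrite sumEFin lee_fin -mulr_sumr ler_piMr ?(ltW m0)//.
  under eq_bigr do rewrite -opprB.
  rewrite sumrN telescope_sumr// opprB /= invr1 gerBl.
  by rewrite harmonic_ge0.
have f0 n w : 0 <= f n w by exact: sqr_ge0.
apply: filterS (@ae_cvg0_summable_integral _ _ _ _ f mf f0 sumf) => w fw.
apply: (@cvg_ratio_nondecreasing R (fun s => (X s w)%:R) t m) => //.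
- by move=> i j ij; rewrite /t ler_pM// ler_nat ltnS.
- apply/cvgryPge => A; near=> n; apply: (@le_trans _ _ n%:R).
    by near: n; exact: nbhs_infty_ger.
  rewrite /t -natrM ler_nat.
  exact: leq_trans (leqnSn n) (leq_pmulr _ _).
- have -> : (fun n => t n / t n.+1) = (fun n => 1 - 2 * harmonic n.+2).
    apply/funext => n; rewrite /t /=.
    have := ltr0Sn R n.+1; have := ltr0Sn R n.+2; rewrite -!natr1 => h1 h2.
    by field; rewrite !gt_eqF.
  have : 1 - 2 * harmonic n.+2 @[n --> \oo] --> (1 - 2 * 0 : R).
    apply: cvgB; first exact: cvg_cst.
    apply: cvgM; first exact: cvg_cst.
    rewrite (cvg_shiftS (fun n => harmonic n.+1 : R)).
    rewrite (cvg_shiftS (harmonic : R^nat)); exact: cvg_harmonic.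
  by rewrite mulr0 subr0.
- by move=> x y x0 xy; rewrite ler_nat Xnd.
- apply/cvgrPdistC_lt => e e0.
  move/cvgrPdistC_lt : fw => /(_ (e ^+ 2)); rewrite exprn_gt0// => /(_ isT).
  apply: filterS => n; rewrite subr0 /f normrX.
  by rewrite ltr_pXn2r// nnegrE ltW.
Unshelve. all: by end_near. Qed.

(** * Uniform distance between exponential distribution functions *)

(** The bound does not depend on [h]: if [a <= b] then the left-hand side is
    [expR (- a h) * (1 - expR (- (b - a) h)) <= (b - a) * h * expR (- a h)],
    and [a * h * expR (- a h) <= 1]. *)
Lemma expR_abs_sub_le (R : realType) (a b h : R) : 0 < a -> 0 < b -> 0 <= h ->
  `|expR (- a * h) - expR (- b * h)| <= `|a - b| / Num.min a b.
Proof.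
move=> a0 b0 h0.
wlog ab : a b a0 b0 / a <= b => [W|].
  case/orP: (le_total a b) => [ab|ba]; first exact: W.
  by rewrite distrC [`|a - b|]distrC minC; exact: W.
rewrite min_l// distrC [`|a - b|]distrC.
rewrite [`|b - a|]ger0_norm ?subr_ge0// ler0_norm; last first.
  by rewrite subr_le0 ler_expR ler_wpM2r// lerN2.
rewrite opprB.
have -> : expR (- b * h) = expR (- a * h) * expR (- ((b - a) * h)).
  by rewrite -expRD; congr expR; ring.
(* From 1 + x <= expR x: 1 - expR (- y) <= y and y * expR (- y) <= 1. *)
have h1 := expR_ge1Dx (- ((b - a) * h)).
have h2 := expR_ge1Dx (a * h).
have e0 := expR_gt0 (- a * h).
have e1 : expR (- a * h) * expR (a * h) = 1.
  by rewrite -expRD mulNr addNr expR0.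
have ahe : expR (- a * h) * (a * h) <= 1 by nra.
rewrite ler_pdivlMr//.
apply: (@le_trans _ _ ((b - a) * (expR (- a * h) * (a * h)))); last first.
  by rewrite ler_piMr// subr_ge0.
have -> : (b - a) * (expR (- a * h) * (a * h)) =
    expR (- a * h) * ((b - a) * h) * a by ring.
rewrite ler_pM2r//.
rewrite -[X in X - _]mulr1 -mulrBr ler_pM2l//; lra.
Qed.

Lemma ereal_sup_G_cvg0 (R : realType) (I : Type) (F : set_system I)
    {FF : Filter F} (m : R) (a : I -> R) : 0 < m ->
  a x @[x --> F] --> m ->
  ereal_sup [set (`|(1 - expR (- a x * h)) - G m h|)%:E
            | h in [set h : R | 0 <= h]]
    @[x --> F] --> 0%E.
Proof.
move=> m0 am.
have m20 : 0 < m / 2 by rewrite divr_gt0.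
(* Once a x > m / 2, the smaller of the two rates exceeds m / 2. *)
apply: (@squeeze_cvge _ _ _ _ (cst 0%E) _
  (fun x => (`|a x - m| / (m / 2))%:E)).
- near=> x; have ax : m / 2 < a x.
    by near: x; apply: (cvgr_gt _ am); lra.
  have a0 : 0 < a x by exact: lt_trans ax.
  apply/andP; split.
    apply: ereal_sup_ubound; exists 0 => //=.
    by rewrite /G !mulr0 expR0 subrr normr0.
  apply: ge_ereal_sup => _ [h h0 <-]; rewrite lee_fin /G.
  have -> : 1 - expR (- a x * h) - (1 - expR (- m * h)) =
      expR (- m * h) - expR (- a x * h) by ring.
  rewrite distrC; have := @expR_abs_sub_le R (a x) m h a0 m0 h0.
  move=> /le_trans; apply; rewrite ler_wpM2l// lef_pV2 ?posrE//; last first.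
    by rewrite lt_min a0.
  by rewrite le_min (ltW ax) /=; lra.
- exact: cvg_cst.
- apply: cvg_EFin; first exact: nearW.
  rewrite (_ : fine \o _ = fun x => `|a x - m| / (m / 2)); last exact/funext.
  have : `|a x - m| / (m / 2) @[x --> F] --> `|m - m| / (m / 2).
    apply: cvgM (cvg_cst _); apply: cvg_norm.
    by apply: cvgB => //; exact: cvg_cst.
  by rewrite subrr normr0 mul0r.
Unshelve. all: by end_near. Qed.

(** * The eventually homogeneous process *)

Lemma cumulative_intensity_sub (R : realType) (lambda : R -> R) (a m s t : R) :
  {within `[0, +oo[, continuous lambda} ->
  0 <= a -> (forall u, a <= u -> lambda u = m) -> a <= s -> s <= t ->
  cumulative_intensity lambda t - cumulative_intensity lambda s = m * (t - s).
Proof.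
move=> lc a0 lm as_ st.
rewrite /cumulative_intensity Rintegral_itvB; last 3 first.
- apply: continuous_compact_integrable; first exact: segment_compact.
  by apply: continuous_subspaceW lc => x /=; rewrite !in_itv/= => /andP[->].
- by rewrite bnd_simp (le_trans a0).
- by rewrite bnd_simp.
rewrite (@eq_Rintegral _ _ _ _ _ (cst m)); last first.
  move=> x; rewrite inE/= in_itv/= => /andP[sx _].
  by rewrite lm// (le_trans as_)// ltW.
rewrite Rintegral_cst// [X in fine X]lebesgue_measure_itv/= lte_fin.
by case: ltgtP st => //= -> _; rewrite subrr.
Qed.

Theorem theorem5p1 (R : realType) (d : measure_display) (T : measurableType d)
    (P : probability T R) (N : R -> T -> nat) (lambda : R -> R)
    (lambda_continuous : {within `[0, +oo[, continuous lambda})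
    (lambda_ge0 : forall t, 0 <= t -> 0 <= lambda t)
    (N_poisson : nonhomogeneous_poisson_process P lambda N)
    (taustar m : R) (taustar_gt0 : 0 < taustar) (m_gt0 : 0 < m)
    (lambda_const : forall t, taustar <= t -> lambda t = m) :
  {ae P, forall w,
    ereal_sup [set (`|G_hat N taustar tau w h - G m h|)%:E
              | h in [set h : R | 0 <= h]]
      @[tau --> +oo] --> 0%E}.
Proof.
have [[mN Nnd] _ _ _ _ PN] := N_poisson.
have ts0 := ltW taustar_gt0.
pose X s := increment N taustar (taustar + s).
have X_rate : {ae P, forall w, (X s w)%:R / s @[s --> +oo] --> m}.
  apply: ae_cvg_poisson_rate => //.
  - move=> s s0; apply: measurable_fun_subn; apply: mN => //.
    exact: addr_ge0.
  - by move=> w s t s0 st; apply/leq_sub2r/Nnd; rewrite ?addr_ge0// lerD2l.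
  - move=> s s0 A; rewrite PN// ?lerDl//.
    rewrite (@cumulative_intensity_sub _ lambda taustar m)// ?lerDl//.
    by rewrite [taustar + s]addrC addrK.
apply: filterS X_rate => w Xw.
apply: ereal_sup_G_cvg0 => //.
have : (X (tau - taustar) w)%:R / (tau - taustar) @[tau --> +oo] --> m.
  apply: (cvg_comp _ _ _ Xw); exact: cvg_addrr.
apply: cvg_trans; apply: near_eq_cvg; near=> tau.
rewrite /m_hat /X /increment addrC subrK natrB//.
apply: Nnd => //; near: tau; apply: nbhs_pinfty_ge; exact: num_real.
Unshelve. all: by end_near. Qed.
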